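(* Let $\mathbb{P}$ and $\mathbb{V}$ be two algebraic theories, $T_{\mathbb{P}}$ a stable universal set of $\mathbb{P}$-terms, and $T_{\mathbb{V}}$ a stable universal set of $\mathbb{V}$-terms. Suppose there are terms $\{1,2\} \vdash_{\mathbb{P}} p$ and $\{1,2\} \vdash_{\mathbb{V}} v$ such that: (P1) $p$ is commutative: $\{1,2\} \vdash_{\mathbb{P}} p(1,2) = p(2,1)$. (P2) $p$ is idempotent: $\{1\} \vdash_{\mathbb{P}} p(1,1) = 1$. (P3) For all $p' \in T_{\mathbb{P}}$ and all $n$: if $\{1,\dots,n\} \vdash_{\mathbb{P}} p(1,2) = p'$, then $\{1,2\} \vdash p'$. (V1) $v$ is idempotent: $\{1\} \vdash_{\mathbb{V}} v(1,1) = 1$. (V2) For all $v' \in T_{\mathbb{V}}$, all variables $x$ and all variable contexts $\Gamma$: if $\Gamma \vdash_{\mathbb{V}} x = v'$, then $\{x\} \vdash v'$. (V3) For all $v' \in T_{\mathbb{V}}$ and all variable contexts $\Gamma$: if $\Gamma \vdash_{\mathbb{V}} v(1,2) = v'$, then neither $\{1\} \vdash v'$ nor $\{2\} \vdash v'$. Then there is no composite theory of $\mathbb{P}$ and $\mathbb{V}$, in the sense in which every term separates as a $\mathbb{P}$-term built from $\mathbb{V}$-terms.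
   Context: An algebraic theory $\mathbb{T}$ consists of a signature $\Sigma^{\mathbb{T}}$ of finitary operation symbols (each with an arity in $\mathbb{N}$) and a set $E^{\mathbb{T}}$ of pairs of $\Sigma^{\mathbb{T}}$-terms (axioms). Variables are natural numbers. For a set $Y$ of variables, $Y \vdash t$ means that all variables of $t$ lie in $Y$ (written $Y\vdash_{\mathbb{T}} t$ when $t$ is a term of $\mathbb{T}$). $t_1 =_{\mathbb{T}} t_2$ means the two terms are provably equal from the axioms in (standard) equational logic, and $Y \vdash_{\mathbb{T}} t_1 = t_2$ means $Y \vdash t_1$, $Y\vdash t_2$ and $t_1 =_{\mathbb{T}} t_2$. $t[f]$ or $t[f(y)/y]$ denotes simultaneous substitution of $f(y)$ for $y$; for a term $p$ in variables $1,2$, $p(a,b)$ denotes $p[a/1,b/2]$. A set of terms of a theory is universal if every term is provably equal to a term in the set, and stable if it is closed under substitution of variables for variables. Composite theory (separating as $\mathbb{P}$-terms of $\mathbb{V}$-terms): a composite of $\mathbb{P}$ and $\mathbb{V}$ is an algebraic theory $\mathbb{U}$ containing both $\mathbb{P}$ and $\mathbb{V}$ (their operations and axioms) such that: 1. Separation: every $\mathbb{U}$-term $u$ satisfies $u =_{\mathbb{U}} t[s_i/x_i]$ for some $\mathbb{P}$-term $t$ and $\mathbb{V}$-terms $s_i$. 2. Essential uniqueness: whenever $X \vdash_{\mathbb{P}} t$, $X' \vdash_{\mathbb{P}} t'$ and $Y_i\vdash_{\mathbb{V}} s_i$ (for $x_i\in X$), $Y'_{i'}\vdash_{\mathbb{V}}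 s'_{i'}$ (for $x'_{i'}\in X'$) are such that $t[s_i/x_i] =_{\mathbb{U}} t'[s'_{i'}/x'_{i'}]$, there are a set of variables $Z$ and functions $f: X \to Z$, $f': X' \to Z$ with: (a) $t[f(x_i)/x_i] =_{\mathbb{P}} t'[f'(x'_{i'})/x'_{i'}]$; (b) $f(x_i)=f(x_j) \Leftrightarrow s_i =_{\mathbb{V}} s_j$; (c) $f'(x'_{i'})=f'(x'_{j'}) \Leftrightarrow s'_{i'} =_{\mathbb{V}} s'_{j'}$; (d) $f(x_i)=f'(x'_{j'}) \Leftrightarrow s_i =_{\mathbb{V}} s'_{j'}$.
   Formalization: The theory P is additionally assumed consistent (1 = 2 is not provable in P); for an inconsistent P meeting the other conditions, an inconsistent composite with V always exists, so the claim fails there. *)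

(* Defs.v *)
From mathcomp Require Import all_boot.
From mathcomp Require Import classical_sets.

Set Implicit Arguments.
Unset Strict Implicit.
Unset Printing Implicit Defensive.

(** [S n] is the collection of operation symbols of arity [n]. *)
Definition signature := nat -> Type.

Inductive term (S : signature) : Type :=
  | Var of nat
  | App n of S n & ('I_n -> term S).

Arguments Var {S} _.
Arguments App {S n} _ _.

Section Terms.
Variable S : signature.
Implicit Types (t : term S) (Y : set nat).

Fixpoint occurs (x : nat) t : Prop :=
  match t with
  | Var y => x = y
  | App _ _ a => exists i, occurs x (a i)
  end.

Definition in_context Y t : Prop := forall x, occurs x t -> Y x.

Fixpoint subst (s : nat -> term S) t : term S :=
  match t with
  | Var x => s x
  | App _ o a => App o (fun i => subst s (a i))
  end.

Definition rename (f : nat -> nat) t : term S := subst (fun x => Var (f x)) t.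

(** [subst2 t a b] is t[a/1, b/2]. *)
Definition subst2 t (a b : term S) : term S :=
  subst (fun x => if x == 1 then a else if x == 2 then b else Var x) t.

End Terms.

Record theory : Type := Theory {
  ops :> signature;
  axioms : set (term ops * term ops)
}.

Inductive provable_eq (T : theory) : term T -> term T -> Prop :=
  | pe_axiom s t : axioms (s, t) -> provable_eq s t
  | pe_refl t : provable_eq t t
  | pe_sym s t : provable_eq s t -> provable_eq t s
  | pe_trans s t u : provable_eq s t -> provable_eq t u -> provable_eq s u
  | pe_congr n (o : ops T n) (a b : 'I_n -> term T) :
      (forall i, provable_eq (a i) (b i)) -> provable_eq (App o a) (App o b)
  | pe_subst (r : nat -> term T) s t :
      provable_eq s t -> provable_eq (subst r s) (subst r t).

Definition eq_in_context (T : theory) (Y : set nat) (s t : term T) : Prop :=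
  [/\ in_context Y s, in_context Y t & provable_eq s t].

(** The inconsistent theory with a constant composes with every [V]: adding an
    axiom x = y that identifies all terms makes [essential_uniqueness] hold. *)
Definition consistent (T : theory) : Prop :=
  ~ provable_eq (Var 1 : term T) (Var 2).

Definition universal (T : theory) (A : set (term T)) : Prop :=
  forall t, exists2 t', A t' & provable_eq t t'.

Definition stable (T : theory) (A : set (term T)) : Prop :=
  forall (f : nat -> nat) t, A t -> A (rename f t).

Fixpoint translate (S S' : signature) (h : forall n, S n -> S' n)
    (t : term S) : term S' :=
  match t with
  | Var x => Var x
  | App n o a => App (h n o) (fun i => translate h (a i))
  end.

(** Inclusion of theories; since signatures are types, not sets, an inclusion
    is an injection on operation symbols. The images of two theories included
    in a third one are not required to be disjoint. *)
Record inclusion (T U : theory) : Type := Inclusion {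
  incl_op : forall n, ops T n -> ops U n;
  incl_inj : forall n, injective (@incl_op n);
  incl_axioms : forall s t, axioms (s, t) ->
    axioms (translate incl_op s, translate incl_op t)
}.

Section Composite.
Variables (P V U : theory) (iP : inclusion P U) (iV : inclusion V U).

(** The [U]-term t[s_x/x]. The values of [s] at variables not occurring in [t]
    are irrelevant, so families [s] indexed by a set of variables are encoded
    by total functions. *)
Definition layered (t : term P) (s : nat -> term V) : term U :=
  subst (fun x => translate (incl_op iV) (s x)) (translate (incl_op iP) t).

Definition separation : Prop :=
  forall u : term U, exists (t : term P) (s : nat -> term V),
    provable_eq u (layered t s).

Definition essential_uniqueness : Prop :=
  forall (X X' : set nat) (Y Y' : nat -> set nat) (t t' : term P)
         (s s' : nat -> term V),
    in_context X t -> in_context X' t' ->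
    (forall x, X x -> in_context (Y x) (s x)) ->
    (forall x, X' x -> in_context (Y' x) (s' x)) ->
    provable_eq (layered t s) (layered t' s') ->
  exists (Z : set nat) (f f' : nat -> nat),
    (forall x, X x -> Z (f x)) /\
    (forall x, X' x -> Z (f' x)) /\
    provable_eq (rename f t) (rename f' t') /\
    (forall x y, X x -> X y -> f x = f y <-> provable_eq (s x) (s y)) /\
    (forall x y, X' x -> X' y -> f' x = f' y <-> provable_eq (s' x) (s' y)) /\
    (forall x y, X x -> X' y -> f x = f' y <-> provable_eq (s x) (s' y)).

End Composite.

(** [U] is a composite of [P] and [V], terms separating as [P]-terms of
    [V]-terms. *)
Definition composite (P V U : theory) : Prop :=
  exists (iP : inclusion P U) (iV : inclusion V U),
    separation iP iV /\ essential_uniqueness iP iV.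

(* Main.v *)
(** Let [w] be the [U]-term v(p(1,2), p(3,4)), separated as a [P]-term [t] of
    [V]-terms [s x].  Identifying 1 = 3, 2 = 4 collapses [w] to p(1,2), and so
    does identifying 1 = 4, 2 = 3 because [p] is commutative.  Essential
    uniqueness then makes every [s x] equal to a variable after either
    identification, so by (V2) the variables of [s x], taken in [TV], lie in
    one of {1,3}, {2,4} and in one of {1,4}, {2,3}: there is at most one.
    Identifying 1 = 2, 3 = 4 instead collapses [w] to v(1,2), which essential
    uniqueness equates with some [s x] having at most one variable; this
    contradicts (V3). *)

Require Import Defs.
From mathcomp Require Import all_boot.
From mathcomp Require Import classical_sets.

Local Open Scope classical_set_scope.

(** * Substitution calculus in equational logic *)

Section EquationalLogic.
Context {T : theory}.
Implicit Types (t u : term T) (r : nat -> term T) (f g : nat -> nat).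

Lemma occurs_subst y r t :
  occurs y (subst r t) <-> exists2 x, occurs x t & occurs y (r x).
Proof.
elim: t => [x|n o a IH] /=; first by split=> [oy|[z ->]//]; exists x.
split=> [[i oi]|[x [i oi] oy]]; last by exists i; apply/IH; exists x.
by have [x ox oy] := (IH i).1 oi; exists x => //; exists i.
Qed.

(** Supplies the bound of the finite contexts in (P3). *)
Lemma occurs_bounded t : exists n, forall x, occurs x t -> x <= n.
Proof.
elim: t => [x|n o a /fin_all_exists[b Hb]]; first by exists x => y ->.
by exists (\max_i b i) => x [i /Hb xb]; apply: leq_trans xb (leq_bigmax i).
Qed.

Lemma subst_ext r r' t :
  (forall x, occurs x t -> provable_eq (r x) (r' x)) ->
  provable_eq (subst r t) (subst r' t).
Proof.
elim: t => [x|n o a IH] H /=; first exact: H.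
by apply: pe_congr => i; apply: IH => x ox; apply: H; exists i.
Qed.

(** Holds up to [provable_eq] rather than [=]: congruence compares argument families pointwise,
    which avoids function extensionality. *)
Lemma subst_subst r r' t :
  provable_eq (subst r (subst r' t)) (subst (fun x => subst r (r' x)) t).
Proof. by elim: t => [x|n o a IH] /=; [exact: pe_refl | exact: pe_congr]. Qed.

Lemma subst_Var t : provable_eq (subst Var t) t.
Proof. by elim: t => [x|n o a IH] /=; [exact: pe_refl | exact: pe_congr]. Qed.

Lemma subst2_Var t : provable_eq (subst2 t (Var 1) (Var 2)) t.
Proof.
apply: pe_trans (subst_Var t); apply: subst_ext => x _.
by do 2![case: eqP => [->|_]; first exact: pe_refl]; exact: pe_refl.
Qed.

(** [subst2] fixes all variables other than 1 and 2, while [r] may move them; hence the context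
    hypothesis. *)
Lemma subst_subst2 r t (a b : term T) : in_context [set 1; 2] t ->
  provable_eq (subst r (subst2 t a b)) (subst2 t (subst r a) (subst r b)).
Proof.
move=> ct; apply: pe_trans (subst_subst _ _ _) _.
by apply: subst_ext => x /ct [] -> /=; exact: pe_refl.
Qed.

Lemma subst2_congr t (a b a' b' : term T) :
  provable_eq a a' -> provable_eq b b' ->
  provable_eq (subst2 t a b) (subst2 t a' b').
Proof.
move=> ha hb; apply: subst_ext => x _.
by do 2![case: eqP => // _]; exact: pe_refl.
Qed.

Lemma subst2_idem t (a : term T) : in_context [set 1; 2] t ->
  provable_eq (subst2 t (Var 1) (Var 1)) (Var 1) ->
  provable_eq (subst2 t a a) a.
Proof.
move=> ct /(pe_subst (fun _ => a)); apply: pe_trans.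
by apply: pe_sym; exact: (subst_subst2 (fun _ => a) t (Var 1) (Var 1)).
Qed.

Lemma subst2_comm t (a b : term T) : in_context [set 1; 2] t ->
  provable_eq (subst2 t (Var 1) (Var 2)) (subst2 t (Var 2) (Var 1)) ->
  provable_eq (subst2 t a b) (subst2 t b a).
Proof.
pose r x := if x == 1 then a else b.
move=> ct /(pe_subst r) h.
apply: pe_trans (subst_subst2 r t (Var 2) (Var 1) ct).
by apply: pe_trans h; apply: pe_sym; exact: (subst_subst2 r t (Var 1) (Var 2)).
Qed.

(* Otherwise substituting two different variables for [x] in the equation
   [x = t] would leave [t] unchanged. *)
Lemma consistent_occurs x t : consistent T -> provable_eq (Var x) t ->
  ~ ~ occurs x t.
Proof.
move=> cT e nox; apply: cT.
have inst y : provable_eq (Var y) t.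
  have /= := pe_subst (fun z => if z == x then Var y else Var z) e.
  rewrite eqxx => /pe_trans; apply; apply: pe_trans (subst_Var t).
  apply: subst_ext => z oz; case: eqP => [zx|_]; last exact: pe_refl.
  by case: nox; rewrite -zx.
exact: pe_trans (inst 1) (pe_sym (inst 2)).
Qed.

End EquationalLogic.

(** * Transport of equations along an inclusion of theories *)

Section Inclusion.
Context {T U : theory} (i : inclusion T U).
Let tr := translate (incl_op i).

Lemma occurs_translate x (t : term T) : occurs x (tr t) -> occurs x t.
Proof. by elim: t => [//|n o a IH] [j /IH oj]; exists j. Qed.

Lemma translate_subst (r : nat -> term T) (t : term T) :
  provable_eq (tr (subst r t)) (subst (fun x => tr (r x)) (tr t)).
Proof. by elim: t => [x|n o a IH] /=; [exact: pe_refl | exact: pe_congr]. Qed.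

Lemma translate_provable_eq (s t : term T) :
  provable_eq s t -> provable_eq (tr s) (tr t).
Proof.
elim=> {s t} [s t /(incl_axioms i)|t|s t _|s t u _ IH1 _ IH2|n o a b _ IH|r s t _ IH].
- exact: pe_axiom.
- exact: pe_refl.
- exact: pe_sym.
- exact: pe_trans IH1 IH2.
- exact: pe_congr.
apply: pe_trans (translate_subst r s) _.
by apply: pe_trans (pe_subst _ IH) _; apply: pe_sym; exact: translate_subst.
Qed.

Lemma translate_subst2 (t a b : term T) : in_context [set 1; 2] t ->
  provable_eq (tr (subst2 t a b)) (subst2 (tr t) (tr a) (tr b)).
Proof.
move=> ct; apply: pe_trans (translate_subst _ _) _.
by apply: subst_ext => x /occurs_translate/ct [] -> /=; exact: pe_refl.
Qed.

(** The argument [a] ranges over all [U]-terms because [v] will be applied to [P]-terms inside the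
    composite. *)
Lemma translate_idem (t : term T) (a : term U) : in_context [set 1; 2] t ->
  provable_eq (subst2 t (Var 1) (Var 1)) (Var 1) ->
  provable_eq (subst2 (tr t) a a) a.
Proof.
move=> ct /translate_provable_eq h; apply: subst2_idem.
  by move=> x /occurs_translate/ct.
by apply: pe_trans h; apply: pe_sym; exact: translate_subst2.
Qed.

Lemma translate_comm (t : term T) (a b : term U) : in_context [set 1; 2] t ->
  provable_eq (subst2 t (Var 1) (Var 2)) (subst2 t (Var 2) (Var 1)) ->
  provable_eq (subst2 (tr t) a b) (subst2 (tr t) b a).
Proof.
move=> ct /translate_provable_eq h; apply: subst2_comm.
  by move=> x /occurs_translate/ct.
apply: pe_trans (translate_subst2 t (Var 2) (Var 1) ct).
by apply: pe_trans h; apply: pe_sym; exact: translate_subst2.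
Qed.

End Inclusion.

(** * Layered terms and essential uniqueness *)

Section Layered.
Context {P V U : theory} (iP : inclusion P U) (iV : inclusion V U).

Lemma layered_congr (t t' : term P) (s : nat -> term V) :
  provable_eq t t' -> provable_eq (layered iP iV t s) (layered iP iV t' s).
Proof. by move=> /(translate_provable_eq iP); exact: pe_subst. Qed.

Lemma rename_layered f (t : term P) (s : nat -> term V) :
  provable_eq (rename f (layered iP iV t s))
              (layered iP iV t (fun x => rename f (s x))).
Proof.
apply: pe_trans (subst_subst _ _ _) _; apply: subst_ext => x _.
by apply: pe_sym; exact: translate_subst.
Qed.

Lemma essential_uniqueness_occurs (X : set nat) (t t' : term P)
    (s s' : nat -> term V) :
  essential_uniqueness iP iV -> in_context X t ->
  provable_eq (layered iP iV t s) (layered iP iV t' s') ->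
  exists f f' : nat -> nat, [/\ provable_eq (rename f t) (rename f' t'),
    forall x y, X x -> X y -> f x = f y -> provable_eq (s x) (s y) &
    forall x y, X x -> occurs y t' -> f x = f' y -> provable_eq (s x) (s' y)].
Proof.
move=> eu ct e.
have [//|//|//|Z [f [f' [_ [_ [eff [inj [_ cross]]]]]]]] :=
  eu X (fun x => occurs x t') (fun=> setT) (fun=> setT) t t' s s' ct _ _ _ e.
by exists f, f'; split=> // x y ox oy; [case: (inj x y ox oy)
                                       |case: (cross x y ox oy)].
Qed.

(* The renaming [h] normalises the names [f 1], [f 2] produced by essential
   uniqueness to 1, 2, avoiding 0 so that (P3) applies. *)
Lemma layered_binary (TP : set (term P)) (p t : term P) (s : nat -> term V) :
  essential_uniqueness iP iV -> consistent V -> stable TP ->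
  in_context [set 1; 2] p ->
  (forall (p' : term P) (n : nat), TP p' ->
     eq_in_context [set k | 1 <= k <= n] (subst2 p (Var 1) (Var 2)) p' ->
     in_context [set 1; 2] p') ->
  TP t -> provable_eq (layered iP iV p Var) (layered iP iV t s) ->
  forall x, occurs x t ->
    provable_eq (Var 1) (s x) \/ provable_eq (Var 2) (s x).
Proof.
move=> eu cV stP cp P3 tTP e.
have [f [f' [eff inj cross]]] := essential_uniqueness_occurs _ _ _ _ _ eu cp e.
(* A common name would make the variables 1 and 2 provably equal in [V]. *)
have f12 : f 1 <> f 2.
  by move=> f12; apply: cV; apply: inj f12; [left | right].
pose h y := if y == f 1 then 1 else if y == f 2 then 2 else y.+3.
have h1 y : h y = 1 -> y = f 1.
  by rewrite /h; case: eqP => // _; case: eqP.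
have h2 y : h y = 2 -> y = f 2.
  by rewrite /h; case: eqP => // _; case: eqP.
pose p' := rename (h \o f') t.
have [n nP] := occurs_bounded p'.
have p'P : in_context [set 1; 2] p'.
  (* [n] bounds the variables of [p']; adding 2 puts the variables 1 and 2 of [p] in the context as
     well. *)
  apply: (P3 p' n.+2); first exact: stP.
  split=> [x /occurs_subst[y /cp [] ->] /= -> //|x ox|].
    rewrite /= (leq_trans (nP _ ox)) ?leqW // andbT.
    have [y _ /= ->] := (occurs_subst _ _ _).1 ox.
    by rewrite /h; do 2![case: eqP => // _].
  apply: pe_trans (subst2_Var p) _.
  have /= := pe_subst (fun x => Var (h x)) eff.
  move=> /pe_trans/(_ (subst_subst _ _ _)); apply: pe_trans.
  apply: pe_sym; apply: pe_trans (subst_subst _ _ _) _.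
  apply: pe_trans (subst_Var p); apply: subst_ext => x /cp [] -> /=.
    by rewrite /h eqxx; exact: pe_refl.
  by rewrite /h eqxx; case: eqP => [/esym//|_]; exact: pe_refl.
move=> x ox.
have /p'P : occurs (h (f' x)) p' by apply/occurs_subst; exists x.
by case=> [/h1|/h2] /esym fx; [left|right]; apply: cross fx => //; [left|right].
Qed.

End Layered.

(** * Consequences of (V2) and (V3), and the contradiction *)

Lemma nonprojection_consistent {V : theory} (TV : set (term V)) (v : term V) :
  stable TV -> universal TV ->
  (forall (v' : term V) (G : set nat), TV v' ->
     eq_in_context G (subst2 v (Var 1) (Var 2)) v' ->
     ~ in_context [set 1] v' /\ ~ in_context [set 2] v') ->
  consistent V.
Proof.
move=> stV unV V3 triv.
have [t tTV _] := unV v.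
(* If all [V]-terms were equal, v(1,2) would equal a member of [TV] with every variable renamed to
   1, which (V3) forbids. *)
have [|[]] := V3 (rename (fun=> 1) t) setT (stV _ _ tTV).
  split=> //; have /= h a b := pe_subst (fun x => if x == 1 then a else b) triv.
  exact: h.
by move=> x /occurs_subst[].
Qed.

(** (V2) speaks only of members of [TV], so [s] is traded for a representative [t], whose renamings
    stay in [TV] by stability. *)
Lemma rename_eq_Var {V : theory} (TV : set (term V)) (t s : term V) f x y :
  stable TV ->
  (forall (v' : term V) (x : nat) (G : set nat), TV v' ->
     eq_in_context G (Var x) v' -> in_context [set x] v') ->
  TV t -> provable_eq s t -> provable_eq (Var x) (rename f s) ->
  occurs y t -> f y = x.
Proof.
move=> stV V2 tTV st e oy.
apply: (V2 (rename f t) x setT (stV _ _ tTV)); last first.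
  by apply/occurs_subst; exists y.
by split=> //; apply: pe_trans e _; exact: pe_subst.
Qed.

Theorem theorem3p5 (P V : theory)
    (TP : set (term P)) (TV : set (term V)) (p : term P) (v : term V)
    (P_consistent : consistent P)
    (TP_stable : stable TP) (TP_universal : universal TP)
    (TV_stable : stable TV) (TV_universal : universal TV)
    (p_ctx : in_context [set 1; 2] p)
    (v_ctx : in_context [set 1; 2] v)
    (P1 : eq_in_context [set 1; 2]
            (subst2 p (Var 1) (Var 2)) (subst2 p (Var 2) (Var 1)))
    (P2 : eq_in_context [set 1] (subst2 p (Var 1) (Var 1)) (Var 1))
    (P3 : forall (p' : term P) (n : nat), TP p' ->
            eq_in_context [set k | 1 <= k <= n] (subst2 p (Var 1) (Var 2)) p' ->
            in_context [set 1; 2] p')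
    (V1 : eq_in_context [set 1] (subst2 v (Var 1) (Var 1)) (Var 1))
    (V2 : forall (v' : term V) (x : nat) (G : set nat), TV v' ->
            eq_in_context G (Var x) v' -> in_context [set x] v')
    (V3 : forall (v' : term V) (G : set nat), TV v' ->
            eq_in_context G (subst2 v (Var 1) (Var 2)) v' ->
            ~ in_context [set 1] v' /\ ~ in_context [set 2] v') :
  ~ exists U : theory, composite P V U.
Proof.
move=> [U [iP [iV [sep eu]]]].
have cV : consistent V by exact: nonprojection_consistent TV_stable TV_universal V3.
case: P1 P2 V1 => _ _ P1 [_ _ P2] [_ _ V1].
pose A := subst2 (translate (incl_op iP) p).
pose B := subst2 (translate (incl_op iV) v).
have trp_ctx : in_context [set 1; 2] (translate (incl_op iP) p).
  by move=> x /occurs_translate/p_ctx.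
have trv_ctx : in_context [set 1; 2] (translate (incl_op iV) v).
  by move=> x /occurs_translate/v_ctx.
pose w := B (A (Var 1) (Var 2)) (A (Var 3) (Var 4)).
have rename_w f : provable_eq (rename f w)
    (B (A (Var (f 1)) (Var (f 2))) (A (Var (f 3)) (Var (f 4)))).
  apply: pe_trans (subst_subst2 _ _ _ _ trv_ctx) _.
  by apply: subst2_congr; exact: (subst_subst2 (fun x => Var (f x)) _ _ _ trp_ctx).
have [t0 [s w_sep0]] := sep w.
have [t tTP t0t] := TP_universal t0.
(* Renaming acts on the [V]-terms alone, so all identifications of variables share the one [P]-term
   [t]. *)
have w_sep f : provable_eq (rename f w)
    (layered iP iV t (fun x => rename f (s x))).
  apply: pe_trans (rename_layered _ _ _ _ _).
  by apply: pe_subst; apply: pe_trans w_sep0 _; exact: layered_congr.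
have binary f : provable_eq (rename f w) (A (Var 1) (Var 2)) ->
    forall x, occurs x t ->
    provable_eq (Var 1) (rename f (s x)) \/ provable_eq (Var 2) (rename f (s x)).
  move=> wp; apply: (layered_binary iP iV TP p) => //.
  apply: pe_trans (w_sep f); apply: pe_sym; apply: pe_trans wp _.
  by apply: pe_trans (subst2_Var _) _; apply: pe_sym; exact: subst_Var.
(* Entry [x] of each list is the image of the variable [x]. The variable 0 and those above 4 go to
   0, a value distinct from 1 and 2. *)
pose f1 x := nth 0 [:: 0; 1; 2; 1; 2] x.
pose f2 x := nth 0 [:: 0; 1; 2; 2; 1] x.
pose f3 x := nth 0 [:: 0; 1; 1; 2; 2] x.
have w1 : provable_eq (rename f1 w) (A (Var 1) (Var 2)).
  by apply: pe_trans (rename_w f1) _; exact: translate_idem.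
have w2 : provable_eq (rename f2 w) (A (Var 1) (Var 2)).
  apply: pe_trans (rename_w f2) _.
  have swap : provable_eq (A (Var 2) (Var 1)) (A (Var 1) (Var 2)).
    exact: translate_comm.
  apply: pe_trans (subst2_congr _ _ _ _ _ (pe_refl _) swap) _.
  exact: translate_idem.
have w3 : provable_eq (rename f3 w) (translate (incl_op iV) v).
  apply: pe_trans (rename_w f3) _; apply: pe_trans (subst2_Var _).
  by apply: subst2_congr; exact: translate_idem.
(* The term [v] is itself separated, as a [P]-variable carrying the single [V]-term [v]. *)
have e3 : provable_eq (layered iP iV (Var 0) (fun=> v))
    (layered iP iV t (fun x => rename f3 (s x))).
  by apply: pe_trans (w_sep f3); exact: pe_sym.
have v0 : in_context [set 0] (Var 0 : term P) by [].
have [g [g' [egg _ cross]]] := essential_uniqueness_occurs iP iV _ _ _ _ _ eu v0 e3.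
(* The name [g 0] must occur in the renamed [t], which yields an [x] in [t] with [v] equal to the
   renamed [s x]. The goal is [False], so the double negation is harmless. *)
apply: (consistent_occurs _ _ P_consistent egg) => /occurs_subst[x ox gx].
have vs : provable_eq v (rename f3 (s x)) by exact: cross gx.
have [s' s'TV ss'] := TV_universal (s x).
have var_s' f z y : provable_eq (Var z) (rename f (s x)) -> occurs y s' -> f y = z.
  exact: rename_eq_Var TV_stable V2 s'TV ss'.
have [no1 no2] : ~ in_context [set 1] (rename f3 s') /\
                 ~ in_context [set 2] (rename f3 s').
  apply: (V3 _ setT (TV_stable _ _ s'TV)); split=> //.
  apply: pe_trans (subst2_Var v) _; apply: pe_trans vs _; exact: pe_subst.
have [i i1 f1i] : exists2 i, i \in [:: 1; 2] & forall y, occurs y s' -> f1 y = i.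
  by case: (binary f1 w1 x ox) => h; [exists 1|exists 2] => // y; exact: var_s'.
have [j j1 f2j] : exists2 j, j \in [:: 1; 2] & forall y, occurs y s' -> f2 y = j.
  by case: (binary f2 w2 x ox) => h; [exists 1|exists 2] => // y; exact: var_s'.
(* [f1] and [f2] agree at 1 and 2, where [f3] is 1, and differ at 3 and 4, where [f3] is 2;
   elsewhere [f1] is 0, which is not a possible [i]. Hence [f3] is constant on the variables of
   [s']. *)
have f3s' y : occurs y s' -> f3 y = if i == j then 1 else 2.
  move=> oy; move: (f1i y oy) (f2j y oy) i1 j1 => <- <-.
  by move: y {oy} => [|[|[|[|[|y]]]]] //=; rewrite /f1 /= nth_nil.
by case: (i == j) f3s' => f3s'; [apply: no1|apply: no2];
  move=> _ /occurs_subst[y oy /= ->]; exact: f3s'.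
Qed.
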